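(* Consider an $(n-1)$-dimensional manifold in $\mathcal T^n$ parametrized by $(\mathbf n(u),c(u)\boldsymbol\epsilon)$, $u=(u_1,\dots,u_{n-1})$, and let $\Pi_u=\{\mathbf x\in\mathbb R^n:\mathbf n(u)\cdot\mathbf x=c(u)\}$ be the associated family of hyperplanes. Then the envelope of $\{\Pi_u\}$ has the following properties. (i) There is a unique point $\mathbf x_0$ on the envelope corresponding to $u_0$ provided $\mathbf n(u_0),\mathbf n_{u_1}(u_0),\dots,\mathbf n_{u_{n-1}}(u_0)$ are linearly independent. Then the point is the solution $\mathbf x$ of the system of linear equations $\mathbf n(u_0)\cdot\mathbf x=c(u_0)$ and $\mathbf n_{u_i}(u_0)\cdot\mathbf x=c_{u_i}(u_0)$, $i=1,\dots,n-1$. (ii) Provided (i) holds, the envelope is smooth at $\mathbf x_0$ provided $H(\tilde{\mathbf n})\cdot\tilde{\mathbf h}$ is nonsingular for $u=u_0$. (iii) Provided (ii) holds, the normal to the envelope hypersurface at $\mathbf x_0$ is $\mathbf n(u_0)$, and $\Pi_{u_0}$ is its tangent plane at $\mathbf x_0$.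
   Context: $\boldsymbol\epsilon=(1,1)$; $\mathcal T^n=\{(\mathbf n,c\boldsymbol\epsilon)=(\mathbf n,c,c):\mathbf n\in S^{n-1},c\in\mathbb R\}$. Subscripts $u_i$ denote partial derivatives. The envelope of $\{\Pi_u\}$ is the set of points $\mathbf x$ satisfying, for some $u$, $F=0$ and $F_{u_i}=0$ ($i=1,\dots,n-1$), where $F(\mathbf x,u)=\mathbf n(u)\cdot\mathbf x-c(u)$; such $\mathbf x$ corresponds to $u$. The envelope being smooth at the point $\mathbf x_0$ corresponding to $u_0$ means that the envelope points corresponding to $u$ in a sufficiently small neighborhood of $u_0$ form a smooth hypersurface near $\mathbf x_0$. $\tilde{\mathbf n}(u)=(\mathbf n(u),-c(u))\in\mathbb R^{n+1}$. The $n$-fold cross product $v_1\times\cdots\times v_n\in\mathbb R^{n+1}$ is characterized by $v\cdot(v_1\times\cdots\times v_n)=\det(v,v_1,\dots,v_n)$ for all $v$. $\tilde{\mathbf h}=\tilde{\mathbf n}\times\tilde{\mathbf n}_{u_1}\times\cdots\times\tilde{\mathbf n}_{u_{n-1}}$, and $H(\tilde{\mathbf n})\cdot\tilde{\mathbf h}$ is the $(n-1)\times(n-1)$ matrix with entries $\tilde{\mathbf n}_{u_iu_j}\cdot\tilde{\mathbf h}$. *)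

(* Defs.v *)
From HB Require Import structures.
From mathcomp Require Import all_boot all_order all_algebra.
From mathcomp Require Import all_classical all_reals all_analysis.
Set Implicit Arguments.
Unset Strict Implicit.
Unset Printing Implicit Defensive.
Import Order.TTheory GRing.Theory Num.Theory.
Import numFieldNormedType.Exports.
Local Open Scope classical_set_scope.
Local Open Scope ring_scope.

(* R^k is 'rV[R]_k.  Parameters u range over R^m and the ambient space is      *)
(* R^n with n = m.+1, so that n - 1 = m.                                       *)

Section Euclidean.
Variable R : realType.

Definition dot k (x y : 'rV[R]_k) : R := \sum_(i < k) x 0 i * y 0 i.

Definition unit_sphere k : set 'rV[R]_k := [set x | dot x x = 1].

Definition eps : 'rV[R]_2 := const_mx 1.

Definition Tspace n : set 'rV[R]_(n + 2) :=
  [set w | exists v a, unit_sphere v /\ w = row_mx v (a *: eps)].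

(* The rows of A are the factors. *)
Definition cross k (A : 'M[R]_(k, k.+1)) : 'rV[R]_k.+1 :=
  \row_j \det (col_mx (delta_mx 0 j : 'rV[R]_k.+1) A : 'M[R]_k.+1).

Lemma crossP k (A : 'M[R]_(k, k.+1)) (w : 'rV[R]_k.+1) :
  (forall v, dot v w = \det (col_mx v A : 'M[R]_k.+1)) <-> w = cross A.
Proof.
split=> [h|-> v].
  apply/rowP => j; rewrite mxE -h /dot (bigD1 j) //= big1 ?addr0.
    by rewrite mxE !eqxx mul1r.
  by move=> i /negPf ij; rewrite mxE eqxx ij mul0r.
have top (x : 'rV[R]_k.+1) i : (col_mx x A : 'M[R]_k.+1) 0 i = x 0 i.
  by rewrite -(col_mxEu x A 0 i); congr (_ _ i); apply/val_inj.
have cofE (x y : 'rV[R]_k.+1) i :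
    cofactor (col_mx x A : 'M[R]_k.+1) 0 i
    = cofactor (col_mx y A : 'M[R]_k.+1) 0 i.
  congr (_ * \det _); apply/matrixP => a b; rewrite !mxE.
  by case: splitP => // -[[|//] ?] /=.
rewrite (expand_det_row _ 0) /dot; apply: eq_bigr => j _.
rewrite top mxE; congr (_ * _).
rewrite (expand_det_row _ 0) (bigD1 j) //= big1 ?addr0.
  by rewrite top mxE !eqxx mul1r (cofE _ v).
by move=> i /negPf ij; rewrite top mxE eqxx ij mul0r.
Qed.

End Euclidean.

Section Smooth.
Variable R : realType.

Definition partial m (V : normedModType R) (i : 'I_m) (f : 'rV[R]_m -> V)
  : 'rV[R]_m -> V := 'D_(delta_mx 0 i) f.

(* C^oo on D (meant for open D): all iterated partial derivatives exist and    *)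
(* are continuous at the points of D.                                          *)
Definition smooth_on m (V : normedModType R) (D : set 'rV[R]_m)
    (f : 'rV[R]_m -> V) :=
  forall (s : seq 'I_m) (u : 'rV[R]_m), D u ->
    {for u, continuous (foldr (@partial m V) f s)} /\
    forall i, derivable (foldr (@partial m V) f s) u (delta_mx 0 i).

Definition regular_on k N (D : set 'rV[R]_k) (phi : 'rV[R]_k -> 'rV[R]_N) :=
  [/\ open D, smooth_on D phi
    & forall u, D u -> row_free (\matrix_(i < k) partial i phi u)].

Definition parametrizes k N (D : set 'rV[R]_k) (phi : 'rV[R]_k -> 'rV[R]_N)
    (M : set 'rV[R]_N) :=
  regular_on D phi /\ phi @` D = M.

(* A regular parametrization that is moreover a homeomorphism onto its image. *)
Definition chart k N (D : set 'rV[R]_k) (phi : 'rV[R]_k -> 'rV[R]_N)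
    (M : set 'rV[R]_N) :=
  parametrizes D phi M /\
  exists psi : 'rV[R]_N -> 'rV[R]_k,
    (forall u, D u -> psi (phi u) = u) /\ {within M, continuous psi}.

Definition smooth_submanifold k N (M : set 'rV[R]_N) :=
  forall p, M p -> exists (V : set 'rV[R]_N) (D : set 'rV[R]_k)
    (phi : 'rV[R]_k -> 'rV[R]_N), open_nbhs p V /\ chart D phi (M `&` V).

Definition smooth_hypersurface m (M : set 'rV[R]_m.+1) :=
  smooth_submanifold m M.

Definition smooth_hypersurface_near m (M : set 'rV[R]_m.+1)
    (p : 'rV[R]_m.+1) :=
  M p /\ exists V, open_nbhs p V /\ smooth_hypersurface (M `&` V).

Definition tangent_space N (M : set 'rV[R]_N) (p : 'rV[R]_N) : set 'rV[R]_N :=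
  [set v | exists (e : R) (g : R -> 'rV[R]_N),
    [/\ 0 < e,
        forall k t, `|t| < e -> derivable (derive1n k g) t 1,
        forall t, `|t| < e -> M (g t),
        g 0 = p
      & derive1 g 0 = v]].

Definition tangent_plane N (M : set 'rV[R]_N) (p : 'rV[R]_N) : set 'rV[R]_N :=
  [set p + v | v in tangent_space M p].

Definition normal_vectors N (M : set 'rV[R]_N) (p : 'rV[R]_N) : set 'rV[R]_N :=
  [set w | forall v, tangent_space M p v -> dot w v = 0].

Definition for_small_nbhds m (U : set 'rV[R]_m) (u0 : 'rV[R]_m)
    (P : set 'rV[R]_m -> Prop) :=
  exists W0, [/\ open_nbhs u0 W0, W0 `<=` U
    & forall W, open_nbhs u0 W -> W `<=` W0 -> P W].

End Smooth.

Section Envelope.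
Variables (R : realType) (m : nat).
Variables (nu : 'rV[R]_m -> 'rV[R]_m.+1) (c : 'rV[R]_m -> R).

Definition hyperplane (u : 'rV[R]_m) : set 'rV[R]_m.+1 :=
  [set x | dot (nu u) x = c u].

Definition Ffun (x : 'rV[R]_m.+1) (u : 'rV[R]_m) : R := dot (nu u) x - c u.

Definition corresponds (u : 'rV[R]_m) (x : 'rV[R]_m.+1) :=
  Ffun x u = 0 /\ forall i : 'I_m, partial i (Ffun x) u = 0.

(* The envelope points corresponding to parameters in W; with W the whole      *)
(* parameter domain this is the envelope of the family.                        *)
Definition envelope (W : set 'rV[R]_m) : set 'rV[R]_m.+1 :=
  [set x | exists2 u, W u & corresponds u x].

Definition linear_system (u : 'rV[R]_m) (x : 'rV[R]_m.+1) :=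
  dot (nu u) x = c u /\
  forall i : 'I_m, dot (partial i nu u) x = partial i c u.

Definition frame (u : 'rV[R]_m) : 'M[R]_(1 + m, m.+1) :=
  col_mx (nu u) (\matrix_(i < m) partial i nu u).

Definition ntilde (u : 'rV[R]_m) : 'rV[R]_m.+2 :=
  castmx (erefl, addn1 m.+1) (row_mx (nu u) (- c u)%:M).

Definition htilde (u : 'rV[R]_m) : 'rV[R]_m.+2 :=
  cross (col_mx (ntilde u) (\matrix_(i < m) partial i ntilde u)).

Definition Hmatrix (u : 'rV[R]_m) : 'M[R]_m :=
  \matrix_(i < m, j < m) dot (partial j (partial i ntilde) u) (htilde u).

Definition envelope_smooth_at (U : set 'rV[R]_m) (u0 : 'rV[R]_m)
    (x0 : 'rV[R]_m.+1) :=
  for_small_nbhds U u0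
    (fun W => smooth_hypersurface_near (envelope W) x0).

End Envelope.

(* Main.v *)
Require Import Defs.
From mathcomp Require Import all_boot all_order all_algebra.
From mathcomp Require Import all_classical all_reals all_analysis.
From mathcomp Require Import ring lra.
Set Implicit Arguments.
Unset Strict Implicit.
Unset Printing Implicit Defensive.
Import Order.TTheory GRing.Theory Num.Theory.
Import numFieldNormedType.Exports.
Local Open Scope classical_set_scope.
Local Open Scope ring_scope.

(** The equations of the envelope at [u] say that [frame nu u *m x^T] is the
    column of [c] and its partial derivatives, so near [u0] the envelope is the
    image of the smooth map [x] given by Cramer's rule.  Differentiating
    [nu . x = c] and [nu_i . x = c_i] gives [nu . x_j = 0] and
    [nu_i . x_j = c_ij - nu_ij . x].  On the other hand [htilde] is orthogonal
    to [ntilde] and to its partial derivatives, hence equals [h0 (x, 1)], so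
    that [Hmatrix] is [- h0] times the matrix of the products [nu_i . x_j].  If
    it is nonsingular, then [x] is an immersion at [u0] with tangent space the
    orthogonal of [nu u0].

    The inverse function theorem is not needed: moving one coordinate at a time,
    the mean value theorem shows that [x] is strictly differentiable at [u0], so
    an immersion satisfies [|v - u| <= C |x v - x u|] on a small ball.  This
    makes [x] a homeomorphism onto its image, and controls the parameters along
    an arbitrary curve drawn on the image. *)

(** * Calculus of maps of class C^k *)

Section Ck.
Variables (R : realType) (m : nat) (D : set 'rV[R]_m).
Hypothesis openD : open D.

(** [smooth_on] cut at a finite order, so that closure properties go by induction on [k]. Continuity
    is asked at every level because partial derivatives alone do not give it. *)
Fixpoint Ck (V : normedModType R) (k : nat) (f : 'rV[R]_m -> V) : Prop :=
  (forall u, D u -> {for u, continuous f}) /\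
  if k is k'.+1 then
    forall i, (forall u, D u -> derivable f u (delta_mx 0 i)) /\
      Ck k' (partial i f)
  else True.

Lemma Ck_continuous (V : normedModType R) k (f : 'rV[R]_m -> V) u :
  Ck k f -> D u -> {for u, continuous f}.
Proof. by case: k => [|k] [h _]; apply: h. Qed.

Lemma Ck_derivable (V : normedModType R) k (f : 'rV[R]_m -> V) i u :
  Ck k.+1 f -> D u -> derivable f u (delta_mx 0 i).
Proof. by case=> _ /(_ i)[h _]; exact: h. Qed.

Lemma Ck_partial (V : normedModType R) k (f : 'rV[R]_m -> V) i :
  Ck k.+1 f -> Ck k (partial i f).
Proof. by case=> _ /(_ i)[]. Qed.

Lemma CkW (V : normedModType R) k (f : 'rV[R]_m -> V) : Ck k.+1 f -> Ck k f.
Proof.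
elim: k f => [|k IH] f; first by case.
by case=> cf df; split=> // i; have [di ki] := df i; split=> //; apply: IH.
Qed.

(** [Ck] differentiates [f] itself first, which in [foldr] is the last entry of [s]; hence lists are
    decomposed with [rcons]. *)
Lemma smooth_onP (V : normedModType R) (f : 'rV[R]_m -> V) :
  smooth_on D f <-> forall k, Ck k f.
Proof.
split=> [sf k|sf].
  elim: k f sf => [|k IH] f sf; split=> [u Du|//].
  - by have [] := sf [::] _ Du.
  - by have [] := sf [::] _ Du.
  - move=> i; split=> [u Du|]; first by have [_] := sf [::] _ Du; exact.
    by apply: IH => s u Du; have := sf (rcons s i) _ Du; rewrite foldr_rcons.
move=> s; have: Ck (size s).+1 f by exact: sf.
elim/last_ind: s f {sf} => [|s i IH] f.
  by move=> kf u Du; split=> [|i]; [exact: Ck_continuous kf _|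
    exact: Ck_derivable kf _].
by rewrite size_rcons foldr_rcons => /(@Ck_partial _ _ _ i); exact: IH.
Qed.

Lemma open_near_eq (V : normedModType R) (f g : 'rV[R]_m -> V) u :
  (forall u, D u -> f u = g u) -> D u -> \forall u \near u, f u = g u.
Proof.
by move=> fg Du; near=> w; apply: fg; near: w; exact: open_nbhs_nbhs.
Unshelve. all: by end_near. Qed.

Lemma near_eq_continuous (V : normedModType R) (f g : 'rV[R]_m -> V) u :
  (\forall u \near u, f u = g u) -> {for u, continuous f} ->
  {for u, continuous g}.
Proof.
move=> fg; rewrite /prop_for /continuous_at -(nbhs_singleton fg) => cf.
apply: cvg_trans cf; apply: (@near_eq_cvg _ _ (nbhs u)).
by near=> w; near: w.
Unshelve. all: by end_near. Qed.

(** Since [D] is open, equality on [D] holds near each of its points and passes to partial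
    derivatives. Formulas valid only on [D] can thus be substituted. *)
Lemma Ck_ext (V : normedModType R) k (f g : 'rV[R]_m -> V) :
  (forall u, D u -> f u = g u) -> Ck k f -> Ck k g.
Proof.
elim: k f g => [|k IH] f g fg [cf df]; split=> [u Du|//].
- exact: near_eq_continuous (open_near_eq fg Du) (cf u Du).
- exact: near_eq_continuous (open_near_eq fg Du) (cf u Du).
- move=> i; have [di ki] := df i; split=> [u Du|].
    by apply: near_eq_derivable (di u Du); apply: open_near_eq.
  apply: IH ki => u Du; apply: near_eq_derive; exact: open_near_eq.
Qed.

Lemma Ck_cst (V : normedModType R) k (a : V) : Ck k (cst a).
Proof.
elim: k a => [|k IH] a; split=> [u _|//].
- exact: cst_continuous.
- exact: cst_continuous.
move=> i.
split=> [u _|]; first exact: derivable_cst.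
by rewrite (_ : partial i _ = cst 0) //; apply/funext => u; apply: derive_cst.
Qed.

Lemma CkD (V : normedModType R) k (f g : 'rV[R]_m -> V) :
  Ck k f -> Ck k g -> Ck k (fun u => f u + g u).
Proof.
elim: k f g => [|k IH] f g kf kg; split=> [u Du|//].
- exact: (continuousD (Ck_continuous kf Du) (Ck_continuous kg Du)).
- exact: (continuousD (Ck_continuous kf Du) (Ck_continuous kg Du)).
- move=> i; split=> [u Du|].
    by apply: derivableD; [exact: Ck_derivable kf _|exact: Ck_derivable kg _].
  apply: Ck_ext (IH _ _ (Ck_partial i kf) (Ck_partial i kg)) => u Du.
  by rewrite /partial -deriveD //;
    [exact: Ck_derivable kf _|exact: Ck_derivable kg _].
Qed.

Lemma CkM k (f g : 'rV[R]_m -> R) :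
  Ck k f -> Ck k g -> Ck k (fun u => f u * g u).
Proof.
elim: k f g => [|k IH] f g kf kg; split=> [u Du|//].
- exact: (continuousM (Ck_continuous kf Du) (Ck_continuous kg Du)).
- exact: (continuousM (Ck_continuous kf Du) (Ck_continuous kg Du)).
- move=> i; split=> [u Du|].
    by apply: derivableM; [exact: Ck_derivable kf _|exact: Ck_derivable kg _].
  apply: Ck_ext (CkD (IH _ _ (CkW kf) (Ck_partial i kg))
                     (IH _ _ (CkW kg) (Ck_partial i kf))) => u Du.
  by rewrite [RHS]deriveM //;
    [exact: Ck_derivable kf _|exact: Ck_derivable kg _].
Qed.

Lemma CkN k (f : 'rV[R]_m -> R) : Ck k f -> Ck k (fun u => - f u).
Proof.
move=> kf; apply: Ck_ext (CkM (Ck_cst k (-1 : R)) kf) => u _.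
by rewrite /cst mulN1r.
Qed.

(** The derivative of [1/f] is [- (1/f)^2] times that of [f], so order [k] for [1/f], known by
    induction, yields order [k+1]. *)
Lemma CkV k (f : 'rV[R]_m -> R) :
  (forall u, D u -> f u != 0) -> Ck k f -> Ck k (fun u => (f u)^-1).
Proof.
move=> f0; elim: k => [|k IH] kf; split=> [u Du|//].
- exact: (continuousV (f0 _ Du) (Ck_continuous kf Du)).
- exact: (continuousV (f0 _ Du) (Ck_continuous kf Du)).
- move=> i; split=> [u Du|].
    by apply: derivableV; [exact: f0|exact: Ck_derivable kf _].
  have kV := IH (CkW kf).
  apply: Ck_ext (CkM (CkN (CkM kV kV)) (Ck_partial i kf)) => u Du.
  rewrite [RHS]deriveV ?f0//; last exact: Ck_derivable kf _.
  by rewrite expr2 invfM.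
Qed.

Lemma Ck_sum k (I : Type) (r : seq I) (P : pred I) (F : I -> 'rV[R]_m -> R) :
  (forall i, P i -> Ck k (F i)) -> Ck k (fun u => \sum_(i <- r | P i) F i u).
Proof.
move=> kF; elim: r => [|i r IH].
  by apply: Ck_ext (Ck_cst k (0 : R)) => u _; rewrite big_nil.
case: (boolP (P i)) => Pi.
  by apply: Ck_ext (CkD (kF _ Pi) IH) => u _; rewrite big_cons Pi.
by apply: Ck_ext IH => u _; rewrite big_cons (negPf Pi).
Qed.

Lemma Ck_prod k (I : Type) (r : seq I) (F : I -> 'rV[R]_m -> R) :
  (forall i, Ck k (F i)) -> Ck k (fun u => \prod_(i <- r) F i u).
Proof.
move=> kF; elim: r => [|i r IH].
  by apply: Ck_ext (Ck_cst k (1 : R)) => u _; rewrite big_nil.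
by apply: Ck_ext (CkM (kF i) IH) => u _; rewrite big_cons.
Qed.

Lemma Ck_det k n (A : 'rV[R]_m -> 'M[R]_n) :
  (forall i j, Ck k (fun u => A u i j)) -> Ck k (fun u => \det (A u)).
Proof.
move=> kA; rewrite /determinant; apply: Ck_sum => s _.
by apply: CkM; [exact: Ck_cst|apply: Ck_prod => i; exact: kA].
Qed.

(** * Matrix-valued maps, entry by entry *)

Lemma cvg_mxP (T : Type) (F : set_system T) {FF : Filter F} p q
    (f : T -> 'M[R]_(p, q)) (a : 'M[R]_(p, q)) :
  (forall i j, f x i j @[x --> F] --> a i j) -> f @ F --> a.
Proof.
move=> fa; apply/cvgrPdist_le => e e0; near=> x.
rewrite [leLHS]/Num.Def.normr/= mx_normrE (bigmax_le _ (ltW e0))//= => -[i j] _.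
rewrite !mxE /=; move: i j; near: x.
apply: filter_forall => i; apply: filter_forall => j.
by have /cvgrPdist_le/(_ e e0) := fa i j.
Unshelve. all: by end_near. Qed.

Lemma continuous_mx p q (F : 'rV[R]_m -> 'M[R]_(p, q)) u :
  (forall i j, {for u, continuous (fun u => F u i j)}) ->
  {for u, continuous F}.
Proof. by move=> cF; apply: (@cvg_mxP _ (nbhs u)) => i j; exact: cF. Qed.

Lemma partial_mx p q (F : 'rV[R]_m -> 'M[R]_(p, q)) i u a b :
  derivable F u (delta_mx 0 i) ->
  partial i F u a b = partial i (fun u => F u a b) u.
Proof. by move=> dF; rewrite /partial derive_mx// mxE. Qed.

Lemma Ck_mxP k p q (F : 'rV[R]_m -> 'M[R]_(p, q)) :
  Ck k F <-> forall a b, Ck k (fun u => F u a b).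
Proof.
elim: k F => [|k IH] F; split.
- move=> [cF _] a b; split=> // u Du.
  exact: (continuous_comp (cF u Du) (@coord_continuous _ _ _ a b _)).
- move=> kF; split=> [u Du|//]; apply: continuous_mx => a b.
  by have [+ _] := kF a b; exact.
- move=> kF a b; split=> [u Du|i].
    exact: (continuous_comp (Ck_continuous kF Du)
      (@coord_continuous _ _ _ a b _)).
  split=> [u Du|].
    by have /derivable_mxP := @Ck_derivable _ _ _ i _ kF Du; exact.
  have /IH/(_ a b) := Ck_partial i kF; apply: Ck_ext => u Du.
  by apply: partial_mx; exact: Ck_derivable kF Du.
- move=> kF; split=> [u Du|i].
    by apply: continuous_mx => a b; exact: (Ck_continuous (kF a b) Du).
  have dF u : D u -> derivable F u (delta_mx 0 i).
    by move=> Du; apply/derivable_mxP => a b; exact: Ck_derivable (kF a b) _.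
  split=> //; apply/IH => a b; apply: Ck_ext (Ck_partial i (kF a b)) => u Du.
  by rewrite [RHS]partial_mx //; exact: dF.
Qed.

End Ck.

(** * Strict differentiability *)

Section StrictDifferentiability.
Variable R : realType.

(** Turns neighborhoods into statements about all small radii, so that finitely many of them can
    share one radius. *)
Lemma near_right_ball (V : normedModType R) (x : V) (P : set V) :
  (\forall y \near x, P y) -> \forall d \near 0^'+, forall y, ball x d y -> P y.
Proof.
move=> /nbhs_ballP[e /= e0 eP]; near=> d => y yd.
by apply: eP; apply: le_ball yd; apply/ltW; near: d; exact: nbhs_right_lt.
Unshelve. all: by end_near. Qed.

Lemma ball_rowP n (x y : 'rV[R]_n) d :
  ball x d y <-> 0 < d /\ forall j, `|x 0 j - y 0 j| < d.
Proof.
split=> -[d0 xy]; split=> // i; first exact: xy.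
by move=> j; rewrite (ord1 i); exact: xy.
Qed.

Lemma norm_coord_le p q (A : 'M[R]_(p, q)) i j : `|A i j| <= `|A|.
Proof.
rewrite [leRHS]/Num.Def.normr/= mx_normrE.
exact: (le_bigmax _ (fun ij : 'I_p * 'I_q => `|A ij.1 ij.2|) (i, j)).
Qed.

Lemma norm_mx_le p q (A : 'M[R]_(p, q)) e :
  0 <= e -> (forall i j, `|A i j| <= e) -> `|A| <= e.
Proof.
move=> e0 Ae; rewrite [leLHS]/Num.Def.normr/= mx_normrE.
by rewrite (bigmax_le _ e0)// => -[i j] _; exact: Ae.
Qed.

Lemma norm_mulmx_le p q r (A : 'M[R]_(p, q)) (B : 'M[R]_(q, r)) :
  `|A *m B| <= q%:R * (`|A| * `|B|).
Proof.
apply: norm_mx_le => [|i j]; first by rewrite !mulr_ge0.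
rewrite mxE (le_trans (ler_norm_sum _ _ _))//.
apply: (@le_trans _ _ (\sum_(k < q) (`|A| * `|B|))).
  by apply: ler_sum => k _; rewrite normrM ler_pM// norm_coord_le.
by rewrite sumr_const card_ord mulr_natl.
Qed.

(** The two difference quotients are the same function of [h]. *)
Lemma is_derive_line (V W : normedModType R) (f : V -> W) (v w : V) (t : R) :
  derivable f (t *: v + w) v ->
  is_derive t 1 (fun s => f (s *: v + w)) ('D_v f (t *: v + w)).
Proof.
move=> df; have E :
  (fun h : R => h^-1 *: (((fun s => f (s *: v + w)) \o shift t) (h *: 1)
    - f (t *: v + w))) =
  (fun h => h^-1 *: ((f \o shift (t *: v + w)) (h *: v) - f (t *: v + w))).
  apply/funext => h /=; congr (_ *: (f _ - _)).
  by rewrite [h%:A]mulr1 scalerDl addrA.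
by split; [rewrite /derivable E|rewrite /derive E].
Qed.

(** Min and max are used because the coordinates of two points come in no fixed order. *)
Definition between (a b t : R) := Num.min a b <= t <= Num.max a b.

Variable m : nat.
Implicit Types (f : 'rV[R]_m -> R) (u v w : 'rV[R]_m).

Lemma partial_MVT f w i (a b : R) :
  (forall t, between a b t ->
    derivable f (t *: delta_mx 0 i + w) (delta_mx 0 i)) ->
  exists2 t, between a b t &
    f (b *: delta_mx 0 i + w) - f (a *: delta_mx 0 i + w)
    = partial i f (t *: delta_mx 0 i + w) * (b - a).
Proof.
have ordered (c d : R) : c <= d ->
  (forall t, c <= t <= d ->
    derivable f (t *: delta_mx 0 i + w) (delta_mx 0 i)) ->
  exists2 t, c <= t <= d &
    f (d *: delta_mx 0 i + w) - f (c *: delta_mx 0 i + w)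
    = partial i f (t *: delta_mx 0 i + w) * (d - c).
  move=> cd df; pose g s := f (s *: delta_mx 0 i + w).
  have dg t : t \in `]c, d[%R ->
      is_derive t 1 g (partial i f (t *: delta_mx 0 i + w)).
    move=> /[!in_itv]/= /andP[ct td]; apply: is_derive_line.
    by apply: df; rewrite !ltW.
  have cg : {within `[c, d], continuous g}.
    apply: derivable_within_continuous => t /[!in_itv]/= tcd.
    by have [] := is_derive_line (df _ tcd).
  by have [t /[!in_itv]/= tcd E] := MVT_segment cd dg cg; exists t.
rewrite /between; case: (leP a b) => [|/ltW] ab df; first exact: ordered.
have [t tab E] := ordered _ _ ab df; exists t => //.
by rewrite -opprB E -mulrN opprB.
Qed.

(** Walk from [u] to [v] along edges of the box, changing one coordinate at a time: [h k] has the
    first [k] coordinates of [v] and the others of [u]. The mean value theorem on each edge gives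
    one term, and the increments telescope. *)
Lemma box_MVT f u v :
  (forall z : 'rV[R]_m, (forall j, between (u 0 j) (v 0 j) (z 0 j)) ->
     forall i, derivable f z (delta_mx 0 i)) ->
  exists xi : 'I_m -> 'rV[R]_m,
    (forall i j, between (u 0 j) (v 0 j) (xi i 0 j)) /\
    f v - f u = \sum_i partial i f (xi i) * (v 0 i - u 0 i).
Proof.
move=> df.
pose h k : 'rV[R]_m := \row_j (if (j < k)%N then v 0 j else u 0 j).
have /choice[xi xiP] : forall i : 'I_m, exists z : 'rV[R]_m,
    (forall j, between (u 0 j) (v 0 j) (z 0 j)) /\
    f (h i.+1) - f (h i) = partial i f z * (v 0 i - u 0 i).
  (* With coordinate [i] erased, the edge from [h i] to [h i.+1] is [t *: delta_mx 0 i + w], for [t]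
     from [u 0 i] to [v 0 i]. *)
  move=> i; pose w := \row_j (if j == i then 0 else h i 0 j).
  have betw t : between (u 0 i) (v 0 i) t ->
      forall j, between (u 0 j) (v 0 j) ((t *: delta_mx 0 i + w) 0 j).
    move=> bt j; rewrite !mxE eqxx /=; case: (eqVneq j i) => [->|ji].
      by rewrite mulr1 addr0.
    rewrite mulr0 add0r /between.
    by case: ifP; rewrite ge_min le_max lexx ?orbT.
  have [t tuv E] := @partial_MVT f w i (u 0 i) (v 0 i)
    (fun t bt => df _ (betw t bt) i).
  exists (t *: delta_mx 0 i + w); split; first exact: betw.
  rewrite -E; congr (f _ - f _); apply/rowP => j; rewrite !mxE eqxx /=.
    case: (eqVneq j i) => [->|ji]; first by rewrite ltnSn mulr1 addr0.
    by rewrite mulr0 add0r ltnS leq_eqVlt val_eqE (negPf ji).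
  case: (eqVneq j i) => [->|ji]; first by rewrite ltnn mulr1 addr0.
  by rewrite mulr0 add0r.
exists xi; split=> [i|]; first by have [] := xiP i.
under eq_bigr do rewrite -(xiP _).2.
rewrite -(big_mkord xpredT (fun i => f (h i.+1) - f (h i))) telescope_sumr//.
by congr (f _ - f _); apply/rowP => j; rewrite !mxE ?ltn_ord.
Qed.

(** Balls of the max norm are boxes, so the intermediate points of [box_MVT] stay in the ball. *)
Lemma between_ball (u0 u v z : 'rV[R]_m) d : ball u0 d u -> ball u0 d v ->
  (forall j, between (u 0 j) (v 0 j) (z 0 j)) -> ball u0 d z.
Proof.
move=> /ball_rowP[d0 du] /ball_rowP[_ dv] bz; apply/ball_rowP; split=> // j.
move: (du j) (dv j) (bz j); rewrite /between !ltr_distlC.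
move=> /andP[u1 u2] /andP[v1 v2] /andP[z1 z2]; apply/andP; split.
  by apply: lt_le_trans z1; rewrite lt_min u1.
by apply: le_lt_trans z2 _; rewrite gt_max u2.
Qed.

Variable D : set 'rV[R]_m.
Hypothesis openD : open D.

(** By [box_MVT] the error is a sum of differences of partial derivatives at points near [u0], each
    times a coordinate of [v - u]; continuity of the partial derivatives makes these differences
    small. *)
Lemma strict_diff_scalar f u0 (e : R) : Ck D 1 f -> D u0 -> 0 < e ->
  \forall d \near 0^'+, forall u v, ball u0 d u -> ball u0 d v ->
    `|f v - f u - \sum_i partial i f u0 * (v 0 i - u 0 i)| <= e * `|v - u|.
Proof.
(* There are [m] error terms; dividing by [m.+1] also covers [m = 0]. *)
move=> kf Du0 e0; pose e' := e / m.+1%:R.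
have e'0 : 0 < e' by rewrite divr_gt0.
have near1 : \forall u \near u0, D u /\
    forall i, `|partial i f u0 - partial i f u| <= e'.
  near=> u; split; first by near: u; exact: open_nbhs_nbhs.
  near: u; apply: filter_forall => i.
  have /(Ck_continuous (D := D)) := Ck_partial i kf => /(_ _ Du0).
  by move/cvgrPdist_le => /(_ _ e'0).
near=> d => u v ud vd.
have dD : forall z, ball u0 d z -> D z /\
    forall i, `|partial i f u0 - partial i f z| <= e'.
  by near: d; exact: near_right_ball.
have [z zuv i|xi [xib ->]] := @box_MVT f u v.
  by have [Dz _] := dD z (between_ball ud vd zuv); exact: Ck_derivable kf Dz.
rewrite -sumrB; under eq_bigr do rewrite -mulrBl.
rewrite (le_trans (ler_norm_sum _ _ _))//.
apply: (@le_trans _ _ (\sum_(i < m) e' * `|v - u|)).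
  apply: ler_sum => i _; rewrite normrM ler_pM//.
    have [_ /(_ i)] := dD _ (between_ball ud vd (xib i)).
    by rewrite distrC.
  by have := norm_coord_le (v - u) 0 i; rewrite !mxE.
rewrite sumr_const card_ord -mulr_natl mulrA ler_wpM2r//.
rewrite /e' mulrCA ger_pMr// ler_pdivrMr// mul1r ler_nat.
exact: leqnSn.
Unshelve. all: by end_near. Qed.

(** Transposed with respect to the usual Jacobian: the differential is [w |-> w *m J], and its image
    is the row space. *)
Definition jacobian_mx N (F : 'rV[R]_m -> 'rV[R]_N) u : 'M[R]_(m, N) :=
  \matrix_(i < m) partial i F u.

Lemma jacobian_mxE N (F : 'rV[R]_m -> 'rV[R]_N) u i j : Ck D 1 F -> D u ->
  jacobian_mx F u i j = partial i (fun u => F u 0 j) u.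
Proof.
by move=> kF Du; rewrite mxE partial_mx//; exact: Ck_derivable kF Du.
Qed.

Lemma strict_diff N (F : 'rV[R]_m -> 'rV[R]_N) u0 (e : R) :
  Ck D 1 F -> D u0 -> 0 < e ->
  \forall d \near 0^'+, forall u v, ball u0 d u -> ball u0 d v ->
    `|F v - F u - (v - u) *m jacobian_mx F u0| <= e * `|v - u|.
Proof.
move=> kF Du0 e0; near=> d => u v ud vd.
apply: norm_mx_le => [|i j]; first by rewrite mulr_ge0// ltW.
rewrite ord1; have -> : (F v - F u - (v - u) *m jacobian_mx F u0) 0 j =
    F v 0 j - F u 0 j
    - \sum_i partial i (fun u => F u 0 j) u0 * (v 0 i - u 0 i).
  rewrite !mxE; congr (_ - _); apply: eq_bigr => k _.
  by rewrite jacobian_mxE// !mxE mulrC.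
have : forall j, forall u v, ball u0 d u -> ball u0 d v ->
    `|F v 0 j - F u 0 j
      - \sum_i partial i (fun u => F u 0 j) u0 * (v 0 i - u 0 i)|
    <= e * `|v - u|; last exact.
near: d; apply: filter_forall => k; apply: strict_diff_scalar => //.
by have /(Ck_mxP openD) := kF; apply.
Unshelve. all: by end_near. Qed.

End StrictDifferentiability.

(** * Immersions and tangent spaces of their images *)

Section Immersions.
Variables (R : realType) (m N : nat) (D : set 'rV[R]_m).
Hypothesis openD : open D.
Implicit Types (F : 'rV[R]_m -> 'rV[R]_N) (u v w : 'rV[R]_m).

(** A right inverse [K] of the Jacobian [J] bounds [|v - u|] by [c |(v - u) *m J|]. Strict
    differentiability with constant [1/(2c)] replaces [(v - u) *m J] by [F v - F u] at the cost of
    [|v - u| / 2], which is absorbed on the left. *)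
Lemma immersion_expanding F u0 : Ck D 1 F -> D u0 ->
  row_free (jacobian_mx F u0) ->
  exists2 C : R, 0 < C & \forall d \near 0^'+, forall u v,
    ball u0 d u -> ball u0 d v -> `|v - u| <= C * `|F v - F u|.
Proof.
move=> kF Du0 /row_freeP[K JK].
pose c : R := N%:R * `|K| + 1.
have c0 : 0 < c by rewrite ltr_wpDl// mulr_ge0.
have cP (y : 'rV[R]_N) : `|y *m K| <= c * `|y|.
  apply: le_trans (norm_mulmx_le _ _) _.
  by rewrite mulrCA mulrC ler_wpM2r// lerDl.
exists (2 * c); first by rewrite mulr_gt0.
have e0 : 0 < (2 * c)^-1 by rewrite invr_gt0 mulr_gt0.
near=> d => u v ud vd.
have : `|F v - F u - (v - u) *m jacobian_mx F u0| <= (2 * c)^-1 * `|v - u|.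
  by move: u v ud vd; near: d; exact: (strict_diff openD kF).
move=> h; have := cP ((v - u) *m jacobian_mx F u0).
rewrite -mulmxA JK mulmx1 => {}cP.
have : c * `|(v - u) *m jacobian_mx F u0| <=
    c * (`|F v - F u| + (2 * c)^-1 * `|v - u|).
  rewrite ler_wpM2l ?(ltW c0)//.
  rewrite -[X in `|X|](subKr (F v - F u)) (le_trans (ler_normB _ _))//.
  by rewrite lerD2l.
move=> /(le_trans cP).
have -> : c * (`|F v - F u| + (2 * c)^-1 * `|v - u|) =
    c * `|F v - F u| + `|v - u| / 2 by field; rewrite gt_eqF.
by rewrite -mulrA; move: (c * `|F v - F u|) (`|v - u|) => a b; lra.
Unshelve. all: by end_near. Qed.

(** For a right inverse [K] at [u0], the determinant of [jacobian_mx F u *m K] is continuous and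
    equals 1 at [u0]. Where it is nonzero, a right inverse exists. *)
Lemma immersion_open F u0 : Ck D 1 F -> D u0 ->
  row_free (jacobian_mx F u0) ->
  \forall u \near u0, row_free (jacobian_mx F u).
Proof.
move=> kF Du0 /row_freeP[K JK].
have kdet : Ck D 0 (fun u => \det (jacobian_mx F u *m K)).
  apply: Ck_det => // i j.
  apply: (@Ck_ext _ _ _ openD _ _
    (fun u => \sum_k partial i (fun u => F u 0 k) u * K k j)).
    move=> u Du; rewrite mxE; apply: eq_bigr => k _.
    by rewrite (jacobian_mxE _ _ kF).
  apply: Ck_sum => // k _; apply: CkM => //; last exact: (Ck_cst _ 0 (K k j)).
  by apply: Ck_partial; have /Ck_mxP := kF; apply.
have [cdet _] := kdet; near=> u.
have det0 : \det (jacobian_mx F u *m K) != 0.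
  by near: u; apply: cvgr_neq0 (cdet _ Du0) _; rewrite JK det1 oner_neq0.
have : jacobian_mx F u *m K \in unitmx by rewrite unitmxE unitfE.
move=> AKu; apply/row_freeP; exists (K *m invmx (jacobian_mx F u *m K)).
by rewrite mulmxA mulmxV.
Unshelve. all: by end_near. Qed.

(** The expansion bound makes [F] injective on [W], and read backwards it is a Lipschitz bound on
    the inverse. *)
Lemma expanding_chart F (W : set 'rV[R]_m) (C : R) :
  regular_on W F ->
  (forall u v, W u -> W v -> `|v - u| <= C * `|F v - F u|) ->
  chart W F (F @` W).
Proof.
move=> regW lipW; split=> //.
(* The preimage in [W], with default value 0 off the image. *)
pose psi p : 'rV[R]_m := xget 0 [set u | W u /\ F u = p].
have psiP p : (F @` W) p -> W (psi p) /\ F (psi p) = p.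
  move=> [u Wu Fu]; have : exists u, W u /\ F u = p by exists u.
  by move=> /(xgetPex 0).
have psiF p q : (F @` W) p -> (F @` W) q -> `|psi q - psi p| <= C * `|q - p|.
  move=> /psiP[Wp pE] /psiP[Wq qE].
  by rewrite -{2}qE -{2}pE; exact: lipW.
exists psi; split=> [u Wu|].
  have [Wp pE] := psiP (F u) (imageP F Wu).
  apply/eqP; rewrite -subr_eq0 -normr_le0.
  by rewrite (le_trans (lipW _ _ Wu Wp))// pE subrr normr0 mulr0.
apply/subspace_continuousP => p Mp; apply/cvgrPdist_le => /= e e0.
(* No sign of [C] is assumed, so a positive upper bound replaces it. *)
have C0 : 0 < `|C| + 1 by rewrite ltr_wpDl.
rewrite near_withinE; near=> q => Mq.
rewrite (le_trans (psiF _ _ Mq Mp))//.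
apply: (@le_trans _ _ ((`|C| + 1) * `|p - q|)).
  by rewrite ler_wpM2r// (le_trans (ler_norm C))// lerDl.
rewrite -ler_pdivlMl//; near: q.
have : 0 < (`|C| + 1)^-1 * e by rewrite mulr_gt0 ?invr_gt0.
by move: (@cvg_id _ (nbhs p)) => /cvgrPdist_le; exact.
Unshelve. all: by end_near. Qed.

(** Strict differentiability applied to the pair [u], [u + h w]; its error [e' |h| |w|] fixes the
    choice of [e']. *)
Lemma is_derive_jacobian F u w : Ck D 1 F -> D u ->
  is_derive u w F (w *m jacobian_mx F u).
Proof.
move=> kF Du; suff h :
    (fun h : R => h^-1 *: ((F \o shift u) (h *: w) - F u)) @ 0^' -->
    w *m jacobian_mx F u.
  by split; [apply/cvg_ex; exists (w *m jacobian_mx F u)|exact: cvg_lim h].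
apply/cvgrPdist_le => /= e e0.
pose e' := e / (`|w| + 1).
have w0 : 0 < `|w| + 1 by rewrite ltr_wpDl.
have e'0 : 0 < e' by rewrite divr_gt0.
have [d [d0 dP]] : exists d : R, 0 < d /\
    forall u1 v, ball u d u1 -> ball u d v ->
    `|F v - F u1 - (v - u1) *m jacobian_mx F u| <= e' * `|v - u1|.
  have Hd := strict_diff openD kF Du e'0.
  by have [d []] := filter_ex (filterI (nbhs_right_gt 0) Hd); exists d.
near=> h.
have h0 : h != 0 by near: h; exact: nbhs_dnbhs_neq.
have hd : `|h| < d / (`|w| + 1).
  by near: h; apply: dnbhs0_lt; rewrite divr_gt0.
have hwd : `|h *: w| < d.
  rewrite normrZ; apply: (@le_lt_trans _ _ (`|h| * (`|w| + 1))).
    by rewrite ler_wpM2l// lerDl.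
  by rewrite -ltr_pdivlMr.
have := dP u (h *: w + u) (ballxx _ d0).
rewrite -ball_normE /= opprD addrCA subrr addr0 normrN addrK => /(_ hwd) H.
rewrite distrC -[w *m _](scalerK h0) scalemxAl -scalerBr normrZ.
rewrite normfV ler_pdivrMl ?normr_gt0// (le_trans H)//.
rewrite normrZ mulrCA ler_wpM2l// /e' -mulrA ger_pMr//.
by rewrite mulrC ler_pdivrMr// mul1r lerDl.
Unshelve. all: by end_near. Qed.

Lemma Ck_jacobian_line k F w : Ck D k.+1 F ->
  Ck D k (fun u => w *m jacobian_mx F u).
Proof.
move=> kF; apply/(Ck_mxP openD) => a b; rewrite ord1.
apply: (@Ck_ext _ _ _ openD _ _
    (fun u => \sum_i w 0 i * partial i (fun u => F u 0 b) u)).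
  move=> u Du; rewrite mxE; apply: eq_bigr => i _.
  rewrite (jacobian_mxE _ _ _ Du)//.
  by elim: k kF => // k IH /CkW.
apply: Ck_sum => // i _; apply: CkM => //; first exact: (Ck_cst _ _ (w 0 i)).
by apply: Ck_partial; have /(Ck_mxP openD) := kF; apply.
Qed.

(* The derivative along a line in direction [w] is again the restriction to
   that line of a C^oo map, which makes the induction on [k] work. *)
Lemma derive1n_line F u w (T : set R) :
  (forall k, Ck D k F) -> open T -> (forall t, T t -> D (t *: w + u)) ->
  forall k t, T t -> derivable (derive1n k (fun t => F (t *: w + u))) t 1.
Proof.
move=> kF oT TD.
pose L k := iter k (fun G u => w *m jacobian_mx G u) F.
have kL k j : Ck D j (L k).
  by elim: k j => [|k IH] j; [exact: kF|exact: Ck_jacobian_line].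
have dL k t : T t ->
    is_derive t 1 (fun t => L k (t *: w + u)) (L k.+1 (t *: w + u)).
  move=> Tt; have [d E] := is_derive_jacobian w (kL k 1%N) (TD _ Tt).
  by rewrite [L k.+1 _]/= -E; apply: is_derive_line.
have E k t : T t -> derive1n k (fun t => F (t *: w + u)) t = L k (t *: w + u).
  elim: k t => [|k IH] t Tt //; rewrite derive1nS derive1E.
  rewrite (near_eq_derive (g := fun t : R => L k (t *: w + u))).
    by have [_] := dL k t Tt.
  by near=> s; apply: IH; near: s; exact: open_nbhs_nbhs.
move=> k t Tt; apply: near_eq_derivable (ex_derive (is_derive := dL k t Tt)).
by near=> s; apply/esym/E; near: s; exact: open_nbhs_nbhs.
Unshelve. all: by end_near. Qed.

(** A curve on the image does not come with a differentiable curve of parameters; expansion bounds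
    the parameter increments instead. Conversely, each [w *m J] is the velocity of the image of a
    line. *)
Lemma tangent_space_image F u0 (W : set 'rV[R]_m) (C : R) :
  (forall k, Ck D k F) -> open W -> W `<=` D -> W u0 ->
  (forall u v, W u -> W v -> `|v - u| <= C * `|F v - F u|) ->
  tangent_space (F @` W) (F u0) =
  [set v | (v <= jacobian_mx F u0)%MS].
Proof.
move=> kF oW WD Wu0 lipW; apply/seteqP; split=> v.
(* Write [g t = F (u t)]: the increment of [g] is [(u t - u0) *m J] up to
   [o(u t - u0)], and [u t - u0] is [O(g t - g 0)] by expansion; hence the
   part of [g' 0] outside the row space of [J] vanishes. *)
- move=> [r [g [r0 dg gM g0 <-]]] /=; set v' := derive1 g 0.
  have : h^-1 *: (g h - g 0) @[h --> 0^'] --> v'.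
    have := dg 0%N 0; rewrite normr0 => /(_ r0).
    rewrite /derivable /v' derive1E /derive /=.
    under eq_fun do rewrite [_%:A]mulr1 addr0.
    by [].
  move=> /cvgrPdist_le gv'.
  set J := jacobian_mx F u0; set K := cokermx J.
  have JK : J *m K = 0 by exact: mulmx_coker.
  rewrite submxE -normr_le0.
  (* Sum of the two errors below, up to the factor [e]: [N |K|] from [v' - q] and
     [N |K| |C| (|v'| + 1)] from [q *m K]. *)
  pose B : R := N%:R * `|K| * (`|C| * (`|v'| + 1) + 1).
  have B0 : 0 <= B.
    by rewrite !mulr_ge0// addr_ge0// mulr_ge0// addr_ge0.
  suff H (e : R) : 0 < e -> e <= 1 -> `|v' *m K| <= B * e.
    apply/ler_addgt0Pr => e e0; rewrite add0r.
    (* The cap at 1 serves the bound [|q| <= |v'| + 1] on the difference quotient. *)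
    pose e1 := Num.min 1 (e / (B + 1)).
    have B1 : 0 < B + 1 by rewrite ltr_wpDl.
    have e10 : 0 < e1 by rewrite lt_min ltr01 divr_gt0.
    have := H e1 e10; rewrite ge_min lexx => /(_ isT)/le_trans; apply.
    apply: (@le_trans _ _ ((B + 1) * e1)).
      by rewrite ler_wpM2r ?(ltW e10)// lerDl.
    by rewrite -ler_pdivlMl// mulrC ge_min lexx orbT.
  move=> e0 e1.
  have [d [d0 dP]] : exists d : R, 0 < d /\
      forall u1 v, ball u0 d u1 -> ball u0 d v ->
      `|F v - F u1 - (v - u1) *m J| <= e * `|v - u1|.
    have Hd := strict_diff openD (kF 1%N) (WD _ Wu0) e0.
    by have [d []] := filter_ex (filterI (nbhs_right_gt 0) Hd); exists d.
  (* Chosen so that [|h| < d'] forces the parameter [uh] into the ball of radius [d]. *)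
  pose d' := d / (`|C| * (`|v'| + 1) + 1).
  have Cv0 : 0 < `|C| * (`|v'| + 1) + 1.
    by rewrite ltr_wpDl// mulr_ge0// addr_ge0.
  have d'0 : 0 < d' by rewrite divr_gt0.
  have /filter_ex[h [h0 [hr [hd hv]]]] : \forall h \near 0^',
      h != 0 /\ `|h| < r /\ `|h| < d' /\ `|v' - h^-1 *: (g h - g 0)| <= e.
    near=> h; split; [by near: h; exact: nbhs_dnbhs_neq|].
    split; [by near: h; exact: dnbhs0_lt|].
    split; [by near: h; exact: dnbhs0_lt|].
    by near: h; exact: gv'.
  have [uh Wuh Fuh] := gM h hr.
  set q := h^-1 *: (g h - g 0).
  have qv : `|q| <= `|v'| + 1.
    rewrite -[q](subKr v') (le_trans (ler_normB _ _))// lerD2l.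
    exact: le_trans hv e1.
  have ghq : g h - g 0 = h *: q by rewrite scalerA divff// scale1r.
  have uhC : `|uh - u0| <= `|h| * (`|C| * (`|v'| + 1)).
    rewrite (le_trans (lipW _ _ Wu0 Wuh))// Fuh -g0 ghq normrZ mulrCA.
    rewrite ler_wpM2l// (@le_trans _ _ (`|C| * `|q|))//.
      by rewrite ler_wpM2r// ler_norm.
    by rewrite ler_wpM2l.
  have uhd : ball u0 d uh.
    rewrite -ball_normE /= distrC (le_lt_trans uhC)//.
    apply: (@le_lt_trans _ _ (`|h| * (`|C| * (`|v'| + 1) + 1))).
      by rewrite ler_wpM2l// lerDl.
    by rewrite -ltr_pdivlMr.
  have := dP _ _ (ballxx u0 d0) uhd; rewrite Fuh -g0 => dPh.
  have hq : `|q *m K| <= N%:R * (e * (`|C| * (`|v'| + 1)) * `|K|).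
    (* As [J *m K = 0], the linear part can be subtracted, leaving only the error of strict
       differentiability. *)
    have -> : q *m K = (h^-1 *: (g h - g 0 - (uh - u0) *m J)) *m K.
      by rewrite /q -!scalemxAl [in RHS]mulmxBl -(mulmxA _ J) JK mulmx0 subr0.
    rewrite (le_trans (norm_mulmx_le _ _))// ler_wpM2l// ler_wpM2r//.
    rewrite normrZ normfV ler_pdivrMl ?normr_gt0//.
    by rewrite (le_trans dPh)// mulrCA ler_wpM2l// ltW.
  have hvq : `|(v' - q) *m K| <= N%:R * (e * `|K|).
    by rewrite (le_trans (norm_mulmx_le _ _))// ler_wpM2l// ler_wpM2r.
  rewrite -[X in X *m K](subrK q) addrC mulmxDl.
  rewrite (le_trans (ler_normD _ _))// (le_trans (lerD hq hvq))//.
  by rewrite le_eqVlt; apply/orP; left; apply/eqP; rewrite /B; ring.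
(* The curve is the image of the line through [u0] in direction [w], cut to times at which it stays
   in [W]. *)
- move=> /= /submxP[w ->]; pose T := [set t : R | W (t *: w + u0)].
  have lcont : continuous (fun t : R => t *: w + u0).
    by move=> t; apply: cvgD; [exact: scalel_continuous|exact: cvg_cst].
  have oT : open T by exact: open_comp oW.
  have T0 : T 0 by rewrite /T /= scale0r add0r.
  have /nbhs_ballP[r /= r0 rT] : nbhs (0 : R) T by exact: open_nbhs_nbhs.
  have {}rT t : `|t| < r -> T t.
    by move=> tr; apply: rT; rewrite -ball_normE /= sub0r normrN.
  exists r, (fun t => F (t *: w + u0)); split=> //.
  - move=> k t /rT Tt; apply: (derive1n_line kF oT) => // s; exact: WD.
  - by move=> t /rT Tt; exists (t *: w + u0).
  - by rewrite scale0r add0r.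
  - have [d E] := is_derive_jacobian w (kF 1%N) (WD _ Wu0).
    rewrite derive1E -E; have := @is_derive_line _ _ _ F w u0 0.
    by rewrite scale0r add0r => /(_ d)[_ ->].
Unshelve. all: by end_near. Qed.

End Immersions.

(** * The envelope of a family of hyperplanes *)

Section Dot.
Variables (R : realType) (m : nat) (D : set 'rV[R]_m).
Hypothesis openD : open D.

Lemma dot_mulmx n (x y : 'rV[R]_n) : dot x y = (x *m y^T) 0 0.
Proof. by rewrite mxE; apply: eq_bigr => i _; rewrite mxE. Qed.

Lemma dotDr n (x y z : 'rV[R]_n) : dot x (y + z) = dot x y + dot x z.
Proof. by rewrite !dot_mulmx linearD mulmxDr mxE. Qed.

Lemma dotZr n a (x y : 'rV[R]_n) : dot x (a *: y) = a * dot x y.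
Proof. by rewrite !dot_mulmx linearZ /= -scalemxAr mxE. Qed.

Lemma dotC n (x y : 'rV[R]_n) : dot x y = dot y x.
Proof. by apply: eq_bigr => i _; rewrite mulrC. Qed.

Lemma dot_eq0 n (x : 'rV[R]_n) : dot x x = 0 -> x = 0.
Proof.
move=> /eqP; rewrite /dot psumr_eq0 => [/allP x0|i _]; last first.
  by rewrite -expr2 sqr_ge0.
apply/rowP => i; have := x0 i; rewrite mem_index_enum => /(_ isT).
by rewrite mulf_eq0 orbb mxE => /eqP.
Qed.

Lemma derive_dot N (F G : 'rV[R]_m -> 'rV[R]_N) i u :
  Ck D 1 F -> Ck D 1 G -> D u ->
  partial i (fun u => dot (F u) (G u)) u
  = dot (partial i F u) (G u) + dot (F u) (partial i G u).
Proof.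
move=> kF kG Du.
have dF j : derivable (fun u => F u 0 j) u (delta_mx 0 i).
  by have /(Ck_mxP openD)/(_ 0 j) kFj := kF; exact: Ck_derivable kFj Du.
have dG j : derivable (fun u => G u 0 j) u (delta_mx 0 i).
  by have /(Ck_mxP openD)/(_ 0 j) kGj := kG; exact: Ck_derivable kGj Du.
rewrite /dot /partial.
have -> : (fun u => \sum_(j < N) F u 0 j * G u 0 j) =
    \sum_(j < N) (fun u => F u 0 j * G u 0 j).
  by apply/funext => w; rewrite fct_sumE.
rewrite derive_sum => [|j]; last exact: derivableM.
rewrite -big_split /=; apply: eq_bigr => j _.
rewrite [LHS]deriveM// -!/(partial i _).
rewrite (partial_mx _ _ (Ck_derivable kF Du)).
rewrite (partial_mx _ _ (Ck_derivable kG Du)).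
by rewrite addrC; congr (_ + _); rewrite [LHS]mulrC.
Qed.

Lemma Ck_dot k N (F G : 'rV[R]_m -> 'rV[R]_N) :
  Ck D k F -> Ck D k G -> Ck D k (fun u => dot (F u) (G u)).
Proof.
move=> /(Ck_mxP openD) kF /(Ck_mxP openD) kG.
by apply: Ck_sum => // j _; apply: CkM.
Qed.

Lemma partial_coord N (F : 'rV[R]_m -> 'rV[R]_N) (g : 'rV[R]_m -> R) i j u :
  Ck D 1 F -> (forall u, D u -> F u 0 j = g u) -> D u ->
  partial i F u 0 j = partial i g u.
Proof.
move=> kF Fg Du; rewrite (partial_mx _ _ (Ck_derivable kF Du)).
by apply: near_eq_derive; exact: (open_near_eq openD).
Qed.

End Dot.

(** * The envelope point as a smooth function of the parameter *)

Section Envelopes.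
Variables (R : realType) (m : nat) (D : set 'rV[R]_m).
Variables (nu : 'rV[R]_m -> 'rV[R]_m.+1) (c : 'rV[R]_m -> R).
Hypothesis openD : open D.
Hypothesis smooth_nu : forall k, Ck D k nu.
Hypothesis smooth_c : forall k, Ck D k c.

Lemma correspondsP u x : D u -> corresponds nu c u x <-> linear_system nu c u x.
Proof.
move=> Du; rewrite /corresponds /linear_system /Ffun.
have dF i : partial i (Ffun nu c x) u = dot (partial i nu u) x - partial i c u.
  have kx : Ck D 1 (cst x : 'rV[R]_m -> _) by exact: Ck_cst.
  have kn := Ck_dot openD (smooth_nu 1) kx.
  rewrite [LHS]deriveB; [|exact: Ck_derivable kn Du|
    exact: Ck_derivable (smooth_c 1) Du].
  congr (_ - _); rewrite [LHS](derive_dot openD _ (smooth_nu 1) kx Du).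
  rewrite /partial derive_cst [X in _ + X](_ : _ = 0) ?addr0//.
  by rewrite /dot big1// => j _; rewrite mxE mulr0.
split=> -[h0 hi]; split.
- by apply/eqP; rewrite -subr_eq0; apply/eqP.
- by move=> i; apply/eqP; rewrite -subr_eq0 -dF; apply/eqP/hi.
- by rewrite h0 subrr.
- by move=> i; rewrite [LHS]dF hi subrr.
Qed.

Let rhs (u : 'rV[R]_m) : 'cV[R]_(1 + m) :=
  col_mx (c u)%:M (\col_i partial i c u).

Lemma frame_mulmx u y : frame nu u *m y^T =
  col_mx (dot (nu u) y)%:M (\col_i dot (partial i nu u) y) :> 'cV[R]_(1 + m).
Proof.
rewrite /frame mul_col_mx; congr col_mx.
  by rewrite [LHS]mx11_scalar -dot_mulmx.
apply/colP => i; rewrite [RHS]mxE dot_mulmx !mxE.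
by apply: eq_bigr => j _; rewrite !mxE.
Qed.

Lemma linear_systemE u x :
  linear_system nu c u x <-> frame nu u *m x^T = rhs u.
Proof.
rewrite frame_mulmx; split=> [[h0 hi]|/eq_col_mx[h0 hi]].
  by congr (col_mx _%:M _) => //; apply/colP => i; rewrite !mxE.
split; first by move/matrixP/(_ 0 0): h0; rewrite !mxE eqxx.
by move=> i; move/colP/(_ i): hi; rewrite !mxE.
Qed.

(* Cramer's rule, so that smoothness is inherited from [nu] and [c]. *)
Definition envelope_point (u : 'rV[R]_m) : 'rV[R]_m.+1 :=
  let A : 'M[R]_m.+1 := frame nu u in
  ((\det A)^-1 *: (\adj A *m (rhs u : 'cV[R]_m.+1)))^T.

Lemma envelope_pointP u x : (frame nu u : 'M[R]_m.+1) \in unitmx ->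
  linear_system nu c u x <-> envelope_point u = x.
Proof.
move=> Au; rewrite linear_systemE /envelope_point.
have -> : forall b : 'cV[R]_m.+1, let A : 'M[R]_m.+1 := frame nu u in
    (\det A)^-1 *: (\adj A *m b) = invmx A *m b.
  by move=> b A; rewrite /invmx Au scalemxAl.
split=> [<-|<-].
  by rewrite (mulKmx Au) trmxK.
by rewrite trmxK; exact: mulKVmx.
Qed.

Hypothesis D_unit : forall u, D u -> (frame nu u : 'M[R]_m.+1) \in unitmx.

Let x := envelope_point.

Lemma Ck_frame k a b : Ck D k (fun u => frame nu u a b).
Proof.
have [i ->|i ->] := split_ordP a.
  have /(Ck_mxP openD)/(_ 0 b) := smooth_nu k.
  by apply: Ck_ext => // u Du; rewrite col_mxEu (ord1 i).
have /(Ck_mxP openD)/(_ 0 b) := Ck_partial i (smooth_nu k.+1).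
by apply: Ck_ext => // u Du; rewrite col_mxEd mxE.
Qed.

(** Cramer's formula is rational in the entries of the frame and of [rhs], with denominator the
    determinant, nonzero on [D]. *)
Lemma Ck_envelope_point k : Ck D k x.
Proof.
have kA a b : Ck D k (fun u => (frame nu u : 'M[R]_m.+1) a b).
  exact: Ck_frame.
apply/(Ck_mxP openD) => a b.
apply: (@Ck_ext _ _ _ openD _ _ (fun u => (\det (frame nu u : 'M[R]_m.+1))^-1 *
   \sum_j (\adj (frame nu u : 'M[R]_m.+1)) b j * (rhs u : 'cV[R]_m.+1) j 0)).
  by move=> u Du; rewrite /x /envelope_point /= !mxE ord1.
apply: CkM => //.
  apply: CkV => //; last exact: Ck_det.
  by move=> u /D_unit; rewrite unitmxE unitfE.
apply: Ck_sum => // j _; apply: CkM => //.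
  (* An entry of the adjugate is a signed minor of the frame. *)
  apply: (@Ck_ext _ _ _ openD _ _ (fun u => (-1) ^+ (j + b) *
      \det (row' j (col' b (frame nu u : 'M[R]_m.+1))))).
    by move=> u _; rewrite mxE.
  apply: CkM => //; first exact: (Ck_cst _ _ ((-1) ^+ (j + b) : R)).
  apply: Ck_det => // p q.
  apply: (@Ck_ext _ _ _ openD _ _ (fun u => (frame nu u : 'M[R]_m.+1)
      (lift j p) (lift b q))) => //.
  by move=> u _; rewrite !mxE.
have [i ->|i ->] := split_ordP (j : 'I_(1 + m)).
  by apply: Ck_ext (smooth_c k) => // u _; rewrite [RHS]col_mxEu mxE ord1.
have := Ck_partial i (smooth_c k.+1).
by apply: Ck_ext => // u _; rewrite [RHS]col_mxEd mxE.
Qed.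

Lemma envelope_pointE u : D u -> linear_system nu c u (x u).
Proof. by move=> Du; exact/envelope_pointP/erefl/D_unit. Qed.

(** Differentiating [nu . x = c] leaves this term once [nu_j . x = c_j] is cancelled. *)
Lemma dot_nu_partial u j : D u -> dot (nu u) (partial j x u) = 0.
Proof.
move=> Du; have := derive_dot openD j (smooth_nu 1) (Ck_envelope_point 1) Du.
have [_ ->//] := envelope_pointE Du.
rewrite [LHS](_ : _ = partial j c u) => [/esym/eqP|].
  by rewrite -subr_eq0 addrAC subrr add0r => /eqP.
apply: near_eq_derive; apply: (open_near_eq openD) Du => w Dw.
by have [] := envelope_pointE Dw.
Qed.

(** The order of differentiation, [j] after [i], is that of entry [(i, j)] of [Hmatrix]. *)
Lemma dot_partial_nu_partial u i j : D u ->
  dot (partial i nu u) (partial j x u)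
  = partial j (partial i c) u - dot (partial j (partial i nu) u) (x u).
Proof.
move=> Du; have := derive_dot openD j (Ck_partial i (smooth_nu 2))
  (Ck_envelope_point 1) Du.
rewrite [LHS](_ : _ = partial j (partial i c) u) => [->|].
  by rewrite addrAC subrr add0r.
apply: near_eq_derive; apply: (open_near_eq openD) Du => w Dw.
by have [_] := envelope_pointE Dw.
Qed.

(** * The lifted normal [ntilde], its cross product [htilde], and [Hmatrix] *)

Let wid := widen_ord (leqnSn m.+1).

Lemma ntilde_wid u k : ntilde nu c u 0 (wid k) = nu u 0 k.
Proof.
rewrite /ntilde castmxE /= -(row_mxEl (nu u) (- c u)%:M).
by congr (row_mx _ _ _ _); apply/val_inj.
Qed.

Lemma ntilde_max u : ntilde nu c u 0 ord_max = - c u.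
Proof.
have <- : row_mx (nu u) (- c u)%:M 0 (rshift m.+1 0) = - c u.
  by rewrite row_mxEr mxE eqxx.
rewrite /ntilde castmxE /=.
by congr (row_mx _ _ _ _); apply/val_inj; rewrite /= ?addn0.
Qed.

Lemma ord_widP (k : 'I_m.+2) : (exists i, k = wid i) \/ k = ord_max.
Proof.
have := ltn_ord k; rewrite ltnS leq_eqVlt => /orP[/eqP km|km].
  by right; apply/val_inj.
by left; exists (Ordinal km); apply/val_inj.
Qed.

Lemma Ck_ntilde k : Ck D k (ntilde nu c).
Proof.
apply/(Ck_mxP openD) => a b; rewrite ord1; have [[i ->]|->] := ord_widP b.
  have /(Ck_mxP openD)/(_ 0 i) := smooth_nu k.
  by apply: Ck_ext => // u _; rewrite ntilde_wid.
by apply: Ck_ext (CkN openD (smooth_c k)) => // u _; rewrite ntilde_max.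
Qed.

Lemma partial_ntilde_wid u i k : D u ->
  partial i (ntilde nu c) u 0 (wid k) = partial i nu u 0 k.
Proof.
move=> Du; rewrite (partial_mx _ _ (Ck_derivable (smooth_nu 1) Du)).
exact: (partial_coord openD _ (Ck_ntilde 1) (fun w _ => ntilde_wid w k) Du).
Qed.

Lemma partial_oppc u i : D u ->  partial i (fun u => - c u) u = - partial i c u.
Proof.
move=> Du; rewrite /partial [LHS]deriveN//.
exact: Ck_derivable (smooth_c 1) Du.
Qed.

Lemma partial_ntilde_max u i : D u ->
  partial i (ntilde nu c) u 0 ord_max = - partial i c u.
Proof.
move=> Du; rewrite -partial_oppc//.
exact: (partial_coord openD _ (Ck_ntilde 1) (fun w _ => ntilde_max w) Du).
Qed.

Lemma partial2_ntilde_wid u i j k : D u ->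
  partial j (partial i (ntilde nu c)) u 0 (wid k)
  = partial j (partial i nu) u 0 k.
Proof.
move=> Du; have kn := Ck_partial i (smooth_nu 2).
rewrite (partial_mx _ _ (Ck_derivable kn Du)).
exact: (partial_coord openD _ (Ck_partial i (Ck_ntilde 2))
  (fun w Dw => partial_ntilde_wid i k Dw) Du).
Qed.

Lemma partial2_ntilde_max u i j : D u ->
  partial j (partial i (ntilde nu c)) u 0 ord_max
  = - partial j (partial i c) u.
Proof.
move=> Du; rewrite (partial_coord openD _ (Ck_partial i (Ck_ntilde 2))
  (fun w Dw => partial_ntilde_max i Dw) Du).
rewrite /partial [LHS]deriveN//.
exact: Ck_derivable (Ck_partial i (smooth_c 2)) Du.
Qed.

Lemma dot_recr (a b : 'rV[R]_m.+2) :
  dot a b = dot (\row_k a 0 (wid k)) (\row_k b 0 (wid k))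
    + a 0 ord_max * b 0 ord_max.
Proof.
rewrite /dot big_ord_recr; congr (_ + _).
by apply: eq_bigr => i _; rewrite !mxE.
Qed.

(** By [crossP] this is a determinant in which row [i] of [A] occurs twice. *)
Lemma cross_orthogonal k (A : 'M[R]_(k, k.+1)) i : dot (row i A) (cross A) = 0.
Proof.
have /(crossP A) -> := erefl (cross A).
apply: (determinant_alternate (i1 := lshift k (0 : 'I_1)) (i2 := rshift 1 i)).
  by rewrite -val_eqE.
by move=> j; rewrite [LHS]col_mxEu [RHS]col_mxEd mxE.
Qed.

(** Orthogonality of [htilde] to [ntilde] and its partial derivatives says that its first
    coordinates solve the envelope system with right-hand side scaled by the last coordinate [h0];
    the frame being invertible, they are [h0 *: x u]. *)
Lemma htildeE u : D u ->
  \row_k htilde nu c u 0 (wid k) = htilde nu c u 0 ord_max *: x u.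
Proof.
move=> Du; set h := htilde nu c u; set h0 := h 0 ord_max; set h' := \row_k _.
pose A := (frame nu u : 'M[R]_m.+1).
have Au : A \in unitmx by exact: D_unit.
have nuh : dot (nu u) h' = h0 * c u.
  have := cross_orthogonal (col_mx (ntilde nu c u)
    (\matrix_(i < m) partial i (ntilde nu c) u)) (lshift m 0).
  rewrite -[row _ _]/(row (lshift m 0) (col_mx _ _ : 'M[R]_(1 + m, _))).
  rewrite rowKu row_id dot_recr -/(htilde nu c u) -/h ntilde_max => /eqP.
  rewrite mulNr subr_eq0 mulrC => /eqP <-; congr (dot _ _).
  by apply/rowP => k; rewrite mxE ntilde_wid.
have dnuh i : dot (partial i nu u) h' = h0 * partial i c u.
  have := cross_orthogonal (col_mx (ntilde nu c u)
    (\matrix_(i < m) partial i (ntilde nu c) u)) (rshift 1 i).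
  rewrite -[row _ _]/(row (rshift 1 i) (col_mx _ _ : 'M[R]_(1 + m, _))).
  rewrite rowKd rowK dot_recr -/(htilde nu c u) -/h.
  rewrite partial_ntilde_max// => /eqP.
  rewrite mulNr subr_eq0 mulrC => /eqP <-; congr (dot _ _).
  by apply/rowP => k; rewrite mxE partial_ntilde_wid.
have E : A *m h'^T = h0 *: (rhs u : 'cV[R]_m.+1).
  rewrite [LHS]frame_mulmx -[RHS]/(h0 *: (col_mx _ _ : 'cV[R]_(1 + m))).
  rewrite scale_col_mx; apply: (f_equal2 (@col_mx R 1 m 1)).
    by rewrite nuh scale_scalar_mx.
  by apply/colP => i; rewrite !mxE.
apply: trmx_inj; rewrite -[LHS](mulKmx Au) E -scalemxAr linearZ /=.
congr (_ *: _); rewrite -(_ : A *m (x u)^T = rhs u :> 'cV[R]_m.+1) ?mulKmx//.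
by apply/linear_systemE; exact: envelope_pointE.
Qed.

(** Entry [(i, j)] is [h0 (nu_ij . x - c_ij)], which is [- h0 (nu_i . x_j)]. *)
Lemma HmatrixE u : D u ->
  Hmatrix nu c u =
  - htilde nu c u 0 ord_max *: (jacobian_mx nu u *m (jacobian_mx x u)^T).
Proof.
move=> Du; apply/matrixP => i j; rewrite [LHS]mxE [RHS]mxE dot_recr.
rewrite htildeE// partial2_ntilde_max//.
have -> : \row_k partial j (partial i (ntilde nu c)) u 0 (wid k) =
    partial j (partial i nu) u.
  by apply/rowP => k; rewrite mxE partial2_ntilde_wid.
have -> : (jacobian_mx nu u *m (jacobian_mx x u)^T) i j =
    dot (partial i nu u) (partial j x u).
  by rewrite mxE; apply: eq_bigr => k _; rewrite !mxE.
by rewrite dotZr dot_partial_nu_partial//; ring.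
Qed.

(** The rank of the product in [HmatrixE] is at most that of its right factor, so the Jacobian of
    [x] has rank [m]. *)
Lemma row_free_jacobian u : D u -> Hmatrix nu c u \in unitmx ->
  row_free (jacobian_mx x u).
Proof.
move=> Du; rewrite HmatrixE// -row_full_unit /row_full => /eqP rkH.
rewrite /row_free eqn_leq rank_leq_row -mxrank_tr -{1}rkH.
by rewrite (leq_trans (mxrankS (scalemx_sub _ (submx_refl _))))// mxrankM_maxr.
Qed.

(** The row space lies in the orthogonal of [nu u], and both have dimension [m]. *)
Lemma sub_jacobian u v : D u -> Hmatrix nu c u \in unitmx -> nu u != 0 ->
  (v <= jacobian_mx x u)%MS = (dot (nu u) v == 0).
Proof.
move=> Du Hu nu0; have Jfree := row_free_jacobian Du Hu.
have Jnu : jacobian_mx x u *m (nu u)^T = 0.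
  apply/matrixP => i a; rewrite ord1 [RHS]mxE -(dot_nu_partial i Du).
  by rewrite dotC dot_mulmx !mxE; apply: eq_bigr => k _; rewrite !mxE.
have /eqmxP -> : (jacobian_mx x u == kermx (nu u)^T)%MS.
  have sJ : (jacobian_mx x u <= kermx (nu u)^T)%MS by apply/sub_kermxP.
  rewrite -(mxrank_leqif_eq sJ) mxrank_ker mxrank_tr rank_rV nu0 subn1 /=.
  exact: Jfree.
apply/sub_kermxP/eqP => [vn|vn].
  by rewrite dotC dot_mulmx vn mxE.
by rewrite [LHS]mx11_scalar -dot_mulmx dotC vn raddf0.
Qed.

End Envelopes.

(** * Uniqueness, smoothness and tangent plane of the envelope *)

Theorem proposition8p1 (R : realType) (m : nat)
    (M : set 'rV[R]_(m.+1 + 2)) (U : set 'rV[R]_m)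
    (nu : 'rV[R]_m -> 'rV[R]_m.+1) (c : 'rV[R]_m -> R) (u0 : 'rV[R]_m)
    (M_manifold : smooth_submanifold m M)
    (M_sub : M `<=` @Tspace R m.+1)
    (M_param : parametrizes U (fun u => row_mx (nu u) (c u *: eps R)) M)
    (Uu0 : U u0)
    (indep : row_free (frame nu u0)) :
  exists x0 : 'rV[R]_m.+1,
    [/\ unique (corresponds nu c u0) x0,
        unique (linear_system nu c u0) x0
      & Hmatrix nu c u0 \in unitmx ->
        envelope_smooth_at nu c U u0 x0 /\
        for_small_nbhds U u0 (fun W =>
          normal_vectors (envelope nu c W) x0 = range (fun a : R => a *: nu u0) /\
          tangent_plane (envelope nu c W) x0 = hyperplane nu c u0)].
Proof.
have [[openU /smooth_onP smooth_phi _] phiU] := M_param.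
have smooth_nu k : Ck U k nu.
  apply/(Ck_mxP openU) => a b; rewrite ord1.
  have /(Ck_mxP openU)/(_ 0 (lshift 2 b)) := smooth_phi k.
  by apply: Ck_ext => // u _; rewrite row_mxEl.
have smooth_c k : Ck U k c.
  have /(Ck_mxP openU)/(_ 0 (rshift m.+1 0)) := smooth_phi k.
  by apply: Ck_ext => // u _; rewrite row_mxEr !mxE mulr1.
(* The inclusion of [M] in [Tspace] is what makes [nu u0] a unit vector. *)
have nu_unit : dot (nu u0) (nu u0) = 1.
  have /M_sub[v [a [v1 /eq_row_mx[-> _]]]] : M (row_mx (nu u0) (c u0 *: eps R)).
    by rewrite -phiU; exists u0.
  exact: v1.
have nu0 : nu u0 != 0.
  apply/eqP => n0; move: nu_unit; rewrite n0 dot_mulmx mul0mx mxE.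
  by move/esym/eqP; rewrite oner_eq0.
have frame_u0 : (frame nu u0 : 'M[R]_m.+1) \in unitmx by rewrite -row_free_unit.
(* Independence is given at [u0] only; it persists on this open set, where the determinant of the
   frame is nonzero. *)
pose D := [set u | U u /\ (frame nu u : 'M[R]_m.+1) \in unitmx].
have Du0 : D u0 by [].
have DU : D `<=` U by move=> u [].
have openD : open D.
  rewrite openE => u [Uu fu]; rewrite /interior.
  have kdet : Ck U 0 (fun u => \det (frame nu u : 'M[R]_m.+1)).
    by apply: Ck_det => // a b; exact: Ck_frame.
  near=> v; split; first by near: v; exact: open_nbhs_nbhs.
  rewrite unitmxE unitfE; near: v.
  apply: cvgr_neq0 (Ck_continuous kdet Uu) _.
  by rewrite -unitfE -unitmxE.
have restrict (V : normedModType R) (f : 'rV[R]_m -> V) :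
    (forall k, Ck U k f) -> forall k, Ck D k f.
  move=> /smooth_onP sf; apply/smooth_onP => s u /DU; exact: sf.
have {}smooth_nu := restrict _ _ smooth_nu.
have {}smooth_c := restrict _ _ smooth_c.
have D_unit u : D u -> (frame nu u : 'M[R]_m.+1) \in unitmx by case.
pose x := envelope_point nu c.
have systemP u y : D u -> linear_system nu c u y <-> x u = y.
  by move=> /D_unit; exact: envelope_pointP.
have envP u y : D u -> corresponds nu c u y <-> x u = y.
  move=> Du; rewrite (correspondsP openD smooth_nu smooth_c)//.
  exact: systemP.
have smooth_x : forall k, Ck D k x by move=> k; exact: Ck_envelope_point.
have sx : smooth_on D x by exact/smooth_onP.
exists (x u0); split.
- by split; [exact/envP|move=> y /(envP _ _ Du0)].
- by split; [exact/systemP|move=> y /(systemP _ _ Du0)].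
move=> Hu0.
have Jfree : row_free (jacobian_mx x u0) by exact: (row_free_jacobian openD).
have [C C0 expand] := immersion_expanding openD (smooth_x 1%N) Du0 Jfree.
(* One radius on which the envelope point is smooth, immersive and expanding; the ball serves as
   [W0] in both conclusions. *)
have [d [d0 [dD [dfree dexp]]]] : exists d : R, 0 < d /\
    ball u0 d `<=` D /\ (forall u, ball u0 d u -> row_free (jacobian_mx x u)) /\
    (forall u v, ball u0 d u -> ball u0 d v -> `|v - u| <= C * `|x v - x u|).
  have nD : \forall u \near u0, D u by exact: open_nbhs_nbhs.
  have nJ := immersion_open openD (smooth_x 1%N) Du0 Jfree.
  have [d [[d0 dD] [dJ de]]] := filter_ex (filterI
    (filterI (nbhs_right_gt 0) (near_right_ball nD))
    (filterI (near_right_ball nJ) expand)).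
  by exists d.
have ball_nbhs : open_nbhs u0 (ball u0 d).
  by split; [exact: ball_open|exact: ballxx].
have envE W : W `<=` ball u0 d -> envelope nu c W = x @` W.
  move=> Wd; apply/seteqP; split=> y [u Wu].
    by move=> /(envP _ _ (dD _ (Wd _ Wu))) <-; exists u.
  by move=> <-; exists u => //; exact/(envP _ _ (dD _ (Wd _ Wu))).
have dexpW W : W `<=` ball u0 d ->
    forall u v, W u -> W v -> `|v - u| <= C * `|x v - x u|.
  by move=> Wd u v /Wd du /Wd dv; exact: dexp.
split; exists (ball u0 d); split=> // [u /dD/DU//|W [oW Wu0] Wd].
- rewrite envE//; split; first by exists u0.
  (* The single chart [x] on [W] covers the whole image, so no cutting down of the ambient space
     occurs. *)
  exists setT; split; first by split; [exact: openT|].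
  rewrite setIT => p Mp; exists setT, W, x.
  split; first by split; [exact: openT|].
  rewrite setIT; apply: expanding_chart (dexpW W Wd).
  by split; [exact: oW|move=> s u /Wd/dD; exact: sx|move=> u /Wd; exact: dfree].
- rewrite envE//.
  have tangentP v : tangent_space (x @` W) (x u0) v <-> dot (nu u0) v = 0.
    rewrite (tangent_space_image openD smooth_x oW (subset_trans Wd dD) Wu0
      (dexpW W Wd)) /=.
    rewrite (sub_jacobian openD smooth_nu smooth_c D_unit _ Du0)//.
    by split=> /eqP.
  split; apply/seteqP; split=> w.
  + move=> nw; exists (dot w (nu u0)) => //; apply/esym/eqP.
    (* The part of [w] orthogonal to [nu u0] is tangent, hence orthogonal to [w] too, so
       [z . z = 0]. *)
    pose z := w - dot w (nu u0) *: nu u0.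
    have zn : dot (nu u0) z = 0.
      by rewrite dotDr -scaleNr dotZr nu_unit mulr1 dotC subrr.
    have zw : dot w z = 0 by apply: nw; apply/tangentP.
    rewrite -subr_eq0 -/z; apply/eqP/dot_eq0.
    rewrite {2}/z dotDr -scaleNr dotZr !(dotC z).
    by rewrite zw zn mulr0 addr0.
  + move=> [a _ <-] v /tangentP nv.
    by rewrite dotC dotZr dotC nv mulr0.
  + move=> [v /tangentP nv <-]; rewrite /hyperplane /= dotDr nv addr0.
    by have /(systemP _ _ Du0)[] := erefl (x u0).
  + rewrite /hyperplane /= => nw.
    exists (w - x u0); last by rewrite addrC subrK.
    apply/tangentP; rewrite dotDr -scaleN1r dotZr nw mulN1r.
    by have /(systemP _ _ Du0)[-> _] := erefl (x u0); rewrite subrr.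
Unshelve. all: by end_near. Qed.
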